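(* Let $a,b\ge1$ be coprime with $\frac ab\le\frac35$, and let $A_{ij}$ denote the coefficient of $u^iv^jw^{a+b-1-i-j}$ in $P_{a/b}(u,v,w)$, with $A_{ij}=0$ for pairs not corresponding to a monomial of $P_{a/b}$. Then the coefficients on the line $i+j=a+b-3$ are log-concave: for every integer $i$, with $j=a+b-3-i$, $$A_{i,j}^2\ge A_{i-1,j+1}\,A_{i+1,j-1}.$$
   Context: Markov polynomials. Let $x,y,z$ be indeterminates. Consider the set consisting of all rationals $\rho\in[0,1]$, each written in lowest terms $\rho=a/b$ with integers $a\ge 0$, $b\ge 1$, together with the formal symbol $1/0$. Define Laurent polynomials $M_\rho(x,y,z)$ recursively by $M_{1/0}=y$, $M_{0/1}=x$, $M_{1/1}=\frac{x^2+y^2}{z}$, and: whenever $a/b$, $c/d$ are in this set with $|ad-bc|=1$ and $(a+2c)/(b+2d)\in[0,1]$, then $M_{\frac{a+2c}{b+2d}}=\big(M_{c/d}^2+M_{\frac{a+c}{b+d}}^2\big)/M_{a/b}$. This determines $M_\rho$ for every rational $\rho\in[0,1]$. Numerator. For coprime $1\le a\le b$, $P_{a/b}(u,v,w)$ denotes the homogeneous polynomial of degree $a+b-1$ such that $M_{a/b}(x,y,z)=P_{a/b}(x^2,y^2,z^2)/(x^{a-1}y^{b-1}z^{a+b-1})$; its existence is known. *)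

(* Defs.v *)
From HB Require Import structures.
From mathcomp Require Import all_boot all_order all_algebra.
From mathcomp Require Import fraction.
From mathcomp Require Import mpoly.
Set Implicit Arguments. Unset Strict Implicit. Unset Printing Implicit Defensive.
Import Order.TTheory GRing.Theory Num.Theory.
Local Open Scope ring_scope.

Notation poly3 := {mpoly int[3]}.
(* The field of rational functions in x, y, z; it contains the Laurent polynomials. *)
Notation K3 := {fraction poly3}.

Definition toK (p : poly3) : K3 := @FracField.tofrac poly3 p.

Definition vx : K3 := toK 'X_0.
Definition vy : K3 := toK 'X_1.
Definition vz : K3 := toK 'X_2.

(* A rational in [0,1] in lowest terms a/b, or the symbol 1/0, is encoded by the
   pair (a, b) of naturals; such pairs are exactly the coprime pairs with
   a <= b, together with (1, 0). *)
Definition markov_index (a b : nat) : bool := coprime a b && ((a <= b) || (b == 0))%N.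

Definition is_markov_family (M : nat -> nat -> K3) : Prop :=
  [/\ M 1%N 0%N = vy, M 0%N 1%N = vx, M 1%N 1%N = (vx ^+ 2 + vy ^+ 2) / vz &
      forall a b c d : nat,
        markov_index a b -> markov_index c d ->
        `|(a * d)%:Z - (b * c)%:Z| = 1 ->
        (a + 2 * c <= b + 2 * d)%N -> (0 < b + 2 * d)%N ->
        M (a + 2 * c)%N (b + 2 * d)%N
          = (M c d ^+ 2 + M (a + c)%N (b + d)%N ^+ 2) / M a b].

Definition sq_subst (P : poly3) : poly3 :=
  P \mPo [tuple ('X_0 : poly3) ^+ 2; ('X_1 : poly3) ^+ 2; ('X_2 : poly3) ^+ 2].

Definition is_markov_numerator (M : nat -> nat -> K3) (a b : nat) (P : poly3) : Prop :=
  P \is (a + b - 1)%N.-homog /\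
  M a b = toK (sq_subst P) / (vx ^+ (a - 1) * vy ^+ (b - 1) * vz ^+ (a + b - 1)).

Definition mon3 (i j k : nat) : 'X_{1..3} :=
  [multinom (nth 0%N [:: i; j; k] l) | l < 3].

Definition coefA (a b : nat) (P : poly3) (i j : int) : int :=
  if (0 <= i) && (0 <= j) && (i + j <= (a + b - 1)%N%:Z) then
    P@_(mon3 `|i|%N `|j|%N (a + b - 1 - `|i| - `|j|)%N)
  else 0.

(* Main.v *)
(* Put u = x^2, v = y^2, w = z^2, s = u + v, p = u / s, q = v / s, W = w / s.
   Clearing monomials and dividing by s^(a+b-1) turns M_{a/b} into G_{a,b} with
     G_{a+2c,b+2d} G_{a,b} = G_{a+c,b+d}^2 + p^a q^b W^(a+b) G_{c,d}^2.
   Modulo W^3 the last term disappears as soon as a + b >= 3, and then log G is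
   affine in (a, b).  Adding the contributions of (1,0), (0,1) and (1,1) gives, for
   1 <= a < b,
     G_{a,b} = 1 + ((b-1) p + (a-1) q) W
       + (C(b-1,2) p^2 + (ab-4a+2) p q + C(a-1,2) q^2) W^2   mod W^3,
   so the coefficients of P_{a/b} with w-degree 2 are those of
   (u + v)^(a+b-5) (C(b-1,2) u^2 + (ab-4a+2) u v + C(a-1,2) v^2).  The quadratic
   factor is log-concave, and multiplication by u + v preserves this. *)
Require Import Defs.
From HB Require Import structures.
From mathcomp Require Import all_boot all_order all_algebra.
From mathcomp Require Import fraction.
From mathcomp Require Import mpoly.
From mathcomp Require Import ring lra zify.
Import Order.TTheory GRing.Theory Num.Theory.
Local Open Scope ring_scope.

(** * Log-concave coefficient sequences *)

(** Comparing all pairs i <= j, and not only i = j, makes the property stable, since it forbids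
    internal zeros: 1 + X^3 satisfies the case i = j, but its product with 1 + X has coefficients 1,
    1, 0, 1, 1. *)
Lemma log_concave_mul1X (p : {poly int}) :
  (forall i, 0 <= p`_i) ->
  (forall i j, (i <= j)%N -> p`_i * p`_j.+2 <= p`_i.+1 * p`_j.+1) ->
  (forall i, 0 <= ((1 + 'X) * p)`_i) /\
  (forall i j, (i <= j)%N ->
    ((1 + 'X) * p)`_i * ((1 + 'X) * p)`_j.+2
      <= ((1 + 'X) * p)`_i.+1 * ((1 + 'X) * p)`_j.+1).
Proof.
move=> p_ge0 p_lc.
have c0 : ((1 + 'X) * p)`_0 = p`_0 by rewrite mulrDl mul1r coefD coefXM addr0.
have cS i : ((1 + 'X) * p)`_i.+1 = p`_i.+1 + p`_i.
  by rewrite mulrDl mul1r coefD coefXM.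
split=> [[|i]|[|i] [|j] // le_ij]; rewrite ?c0 ?cS ?addr_ge0 //.
- have := p_lc 0%N 0%N isT.
  have := p_ge0 0%N; have := p_ge0 1%N; have := p_ge0 2%N; nra.
- have := p_lc 0%N j.+1 isT.
  have := mulr_ge0 (p_ge0 0%N) (p_ge0 j.+1); have := mulr_ge0 (p_ge0 1%N) (p_ge0 j.+1).
  have := mulr_ge0 (p_ge0 1%N) (p_ge0 j.+2); nra.
have H1 := p_lc _ _ le_ij.
have H2 := p_lc i j le_ij.
(* After expansion each side has four terms; one is common, [H1] and [H2] match two pairs, and this
   is the last pair. It takes one use of [p_lc] if i = j and two if i < j. *)
have H3 : p`_i * p`_j.+3 <= p`_i.+2 * p`_j.+1.
  move: le_ij; rewrite ltnS leq_eqVlt => /predU1P[->|lt_ij].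
    by rewrite [leRHS]mulrC; apply: p_lc.
  by apply: (le_trans (p_lc i j.+1 (leqW (ltnW lt_ij)))); apply: p_lc.
nra.
Qed.

Lemma log_concave_mul1Xn (p : {poly int}) (n : nat) :
  (forall i, 0 <= p`_i) ->
  (forall i j, (i <= j)%N -> p`_i * p`_j.+2 <= p`_i.+1 * p`_j.+1) ->
  (forall i, 0 <= ((1 + 'X) ^+ n * p)`_i) /\
  (forall i j, (i <= j)%N ->
    ((1 + 'X) ^+ n * p)`_i * ((1 + 'X) ^+ n * p)`_j.+2
      <= ((1 + 'X) ^+ n * p)`_i.+1 * ((1 + 'X) ^+ n * p)`_j.+1).
Proof.
move=> p_ge0 p_lc; elim: n => [|n [IHn_ge0 IHn_lc]]; first by rewrite expr0 mul1r.
by rewrite exprS -mulrA; apply: log_concave_mul1X.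
Qed.

Lemma log_concave_quadratic (p q r : int) (i j : nat) :
  0 <= p -> 0 <= q -> 0 <= r -> p * r <= q ^+ 2 -> (i <= j)%N ->
  (Poly [:: r; q; p])`_i * (Poly [:: r; q; p])`_j.+2
    <= (Poly [:: r; q; p])`_i.+1 * (Poly [:: r; q; p])`_j.+1.
Proof.
move=> p_ge0 q_ge0 r_ge0 disc le_ij; rewrite !coef_Poly.
by case: i j le_ij => [|[|[|i]]] [|[|[|j]]] //= _;
  rewrite ?mul0r ?mulr0 ?mulr_ge0 // -?expr2 // mulrC.
Qed.

(** * The order filtration on the field of fractions *)

(* Elements N / D of F with phi D nonzero at 0 and phi N divisible by 'X^k: the
   k-th power of the maximal ideal of a discrete valuation ring, except that phi
   is not required to be injective. *)
Definition ord_ge (R : comNzRingType) (S : idomainType) (F : fieldType)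
    (iota : {rmorphism R -> F}) (phi : {rmorphism R -> {poly S}}) (k : nat) (f : F) :=
  exists N D q, [/\ (phi D)`_0 != 0, f * iota D = iota N & phi N = q * 'X^k].

Section OrdGe.
Context (R : comNzRingType) (S : idomainType) (F : fieldType).
Context (iota : {rmorphism R -> F}) (phi : {rmorphism R -> {poly S}}).
Hypothesis iota_inj : injective iota.
Local Notation ord_ge := (ord_ge R S F iota phi).

Lemma iota_neq0 D : (phi D)`_0 != 0 -> iota D != 0.
Proof.
by apply: contraNneq => /eqP; rewrite -(rmorph0 iota) (inj_eq iota_inj) => /eqP->;
  rewrite rmorph0 coef0.
Qed.

Lemma ord_ge_le k l f : (k <= l)%N -> ord_ge l f -> ord_ge k f.
Proof.
move=> le_kl [N [D [q [D0 fD NE]]]]; exists N, D, (q * 'X^(l - k)); split=> //.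
by rewrite -mulrA -exprD subnK.
Qed.

Lemma ord_geW k f : ord_ge k f -> ord_ge 0 f.
Proof. exact: ord_ge_le. Qed.

Lemma ord_geD k f g : ord_ge k f -> ord_ge k g -> ord_ge k (f + g).
Proof.
move=> [N [D [q [D0 fD NE]]]] [N' [D' [q' [D'0 gD' N'E]]]].
exists (N * D' + N' * D), (D * D'), (q * phi D' + q' * phi D); split.
- by rewrite rmorphM coef0M mulf_neq0.
- by rewrite rmorphD !rmorphM /= -fD -gD'; ring.
- by rewrite rmorphD !rmorphM /= NE N'E; ring.
Qed.

Lemma ord_geM k l f g : ord_ge k f -> ord_ge l g -> ord_ge (k + l) (f * g).
Proof.
move=> [N [D [q [D0 fD NE]]]] [N' [D' [q' [D'0 gD' N'E]]]].
exists (N * N'), (D * D'), (q * q'); split.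
- by rewrite rmorphM coef0M mulf_neq0.
- by rewrite !rmorphM /= -fD -gD'; ring.
- by rewrite !rmorphM /= NE N'E exprD; ring.
Qed.

Lemma ord_geMl k f g : ord_ge 0 f -> ord_ge k g -> ord_ge k (f * g).
Proof. exact: ord_geM. Qed.

Lemma ord_geMr k f g : ord_ge k f -> ord_ge 0 g -> ord_ge k (f * g).
Proof. by move=> fk g0; rewrite mulrC; apply: ord_geMl. Qed.

Lemma ord_ge_iota N : ord_ge 0 (iota N).
Proof. by exists N, 1, (phi N); rewrite !rmorph1 coef1 oner_neq0 !mulr1. Qed.

Lemma ord_geN k f : ord_ge k f -> ord_ge k (- f).
Proof. by rewrite -mulN1r -(rmorphN1 iota); apply/ord_geMl/ord_ge_iota. Qed.

Lemma ord_geB k f g : ord_ge k f -> ord_ge k g -> ord_ge k (f - g).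
Proof. by move=> fk gk; apply/ord_geD/ord_geN. Qed.

Lemma ord_ge1 : ord_ge 0 1.
Proof. by rewrite -(rmorph1 iota); apply: ord_ge_iota. Qed.

Lemma ord_geX k f n : ord_ge k f -> ord_ge (k * n) (f ^+ n).
Proof.
move=> fk; elim: n => [|n IHn]; first by rewrite muln0 expr0; apply: ord_ge1.
by rewrite exprS mulnS; apply: ord_geM.
Qed.

Lemma ord_geX0 f n : ord_ge 0 f -> ord_ge 0 (f ^+ n).
Proof. exact: (ord_geX 0). Qed.

Lemma ord_ge_iotaV D : (phi D)`_0 != 0 -> ord_ge 0 (iota D)^-1.
Proof.
move=> D0; exists 1, D, 1; split=> //; last by rewrite !rmorph1 mulr1.
by rewrite mulVf ?rmorph1 ?iota_neq0.
Qed.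

(** If f - 1 = N / D then f = (N + D) / D, and N + D has the same constant term as D under [phi].
    This is what permits division in the recurrence. *)
Lemma ord_ge_unit f : ord_ge 1 (f - 1) -> f != 0 /\ ord_ge 0 f^-1.
Proof.
move=> [N [D [q [D0 fD NE]]]].
have fE : f = iota (N + D) / iota D.
  by apply: (canRL (mulfK (iota_neq0 _ D0))); rewrite rmorphD /= -fD; ring.
have ND0 : (phi (N + D))`_0 != 0.
  by rewrite rmorphD NE coefD coefMX add0r.
split; first by rewrite fE mulf_neq0 ?invr_neq0 ?iota_neq0.
rewrite fE invf_div mulrC; apply: ord_geMr; last exact: ord_ge_iota.
exact: ord_ge_iotaV.
Qed.

(** Returns from orders to actual coefficients. Once the lower coefficients of [phi N] vanish, the
    i-th coefficient of [phi N * phi D] is that of [phi N] times the nonzero constant term of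
    [phi D]. *)
Lemma ord_ge_iota_coef k N i : ord_ge k (iota N) -> (i < k)%N -> (phi N)`_i = 0.
Proof.
move=> [N' [D [q [D0]]]]; rewrite -rmorphM => /iota_inj ND N'E.
have {N'E} : phi N * phi D = q * 'X^k by rewrite -rmorphM /= ND.
move: (phi N) => p /polyP pD; elim/ltn_ind: i => i IHi lt_ik.
have := pD i; rewrite coefMXn lt_ik coefM big_ord_recr /= subnn big1 => [|j _].
  by rewrite add0r => /eqP; rewrite mulf_eq0 (negPf D0) orbF => /eqP.
by rewrite IHi ?mul0r // (ltn_trans _ lt_ik).
Qed.
End OrdGe.

(** * Farey descent *)

Lemma coprime_det1 a b c d :
  (a * d = b * c + 1)%N \/ (b * c = a * d + 1)%N -> coprime a b.
Proof.
rewrite /coprime -dvdn1.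
case=> E; [have := dvdn_mulr d (dvdn_gcdl a b)|have := dvdn_mulr c (dvdn_gcdr a b)];
  rewrite E dvdn_addr ?dvdn_mulr ?dvdn_gcdl ?dvdn_gcdr //.
Qed.

(** Subtractive Euclid: the shears (m, n - m) and (m - n, n) preserve determinants, so a
    decomposition of the smaller pair lifts. The descent ends at (1, 2) = (1, 0) + 2 (0, 1) or at
    its mirror image. *)
Lemma farey_descent m n :
  coprime m n -> (0 < m)%N -> (0 < n)%N -> m != n ->
  exists a b c d, [/\ m = (a + 2 * c)%N, n = (b + 2 * d)%N &
    (a * d = b * c + 1)%N \/ (b * c = a * d + 1)%N].
Proof.
have [k] := ubnP (m + n)%N; elim: k m n => // k IHk m n lt_k co_mn m0 n0 neq_mn.
have [lt_mn|le_nm] := ltnP m n.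
  have [n'E|neq] := eqVneq m (n - m)%N.
    have m1 : m = 1%N.
      by move/eqP: co_mn; rewrite -(subnKC (ltnW lt_mn)) -n'E addnn -mul2n gcdnMl.
    by exists 1%N, 0%N, 0%N, 1%N; split; [lia|lia|left; lia].
  have [|||||a [b [c [d [mE nE det]]]]] := IHk m (n - m)%N; try lia.
    by move: co_mn; rewrite -{1}(subnKC (ltnW lt_mn)) /coprime gcdnDl.
  by exists a, (b + a)%N, c, (d + c)%N; split; [lia|lia|nia].
have lt_nm : (n < m)%N by lia.
have [n'E|neq] := eqVneq n (m - n)%N.
  have n1 : n = 1%N.
    by move/eqP: co_mn; rewrite -(subnKC (ltnW lt_nm)) -n'E addnn -mul2n gcdnC gcdnMl.
  by exists 0%N, 1%N, 1%N, 0%N; split; [lia|lia|right; lia].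
have [|||||a [b [c [d [mE nE det]]]]] := IHk (m - n)%N n; try lia.
  by move: co_mn; rewrite -{1}(subnKC (ltnW lt_nm)) coprime_sym /coprime gcdnDl gcdnC.
by exists (a + b)%N, b, (c + d)%N, d; split; [lia|lia|nia].
Qed.

(** Decomposing (m, n - m) and shearing back by (a, b) -> (a, b + a) makes a <= b and c <= d
    automatic. The exception is m = n - m, that is (1, 2), whose decomposition goes through 1/0. *)
Lemma markov_descent m n :
  coprime m n -> (0 < m < n)%N ->
  m = 1%N /\ n = 2%N \/
  exists a b c d, [/\ m = (a + 2 * c)%N, n = (b + 2 * d)%N, (a <= b)%N, (c <= d)%N &
    (a * d = b * c + 1)%N \/ (b * c = a * d + 1)%N].
Proof.
move=> co_mn /andP[m0 lt_mn].
have co' : coprime m (n - m).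
  by move: co_mn; rewrite -{1}(subnKC (ltnW lt_mn)) /coprime gcdnDl.
have [mE|neq] := eqVneq m (n - m)%N.
  by left; move: co'; rewrite -mE /coprime gcdnn => /eqP; lia.
have [|//|a [b [c [d [mE nE det]]]]] := farey_descent m (n - m) co' m0.
  by rewrite subn_gt0.
by right; exists a, (b + a)%N, c, (d + c)%N; split; [lia|lia|lia|lia|nia].
Qed.

(** * The recurrence modulo W^3 *)

Section Truncation.
Context (R : comNzRingType) (S : idomainType) (F : fieldType).
Context (iota : {rmorphism R -> F}) (phi : {rmorphism R -> {poly S}}).
Hypothesis iota_inj : injective iota.
Local Notation ord_ge := (ord_ge R S F iota phi).

Context (p q W : F).
Hypothesis p_ord : ord_ge 0 p.
Hypothesis q_ord : ord_ge 0 q.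
Hypothesis W_ord : ord_ge 1 W.
Hypothesis two_neq0 : 2 != 0 :> F.
Hypothesis half_ord : ord_ge 0 2^-1.

Ltac ord0 := repeat first
  [ assumption | exact: ord_geW W_ord | exact: ord_ge1 | apply: ord_geX0
  | apply: ord_geB | apply: ord_geD | apply: ord_geN | apply: ord_geMl ].

Definition quad A B := 1 + A * W + B * W ^+ 2.

Lemma ord_ge_quad A B k f : (0 < k)%N -> ord_ge 0 A -> ord_ge 0 B ->
  ord_ge k (f - quad A B) -> ord_ge 1 (f - 1).
Proof.
move=> k0 A0 B0 /(ord_ge_le _ _ _ _ _ 1 _ _ k0) fE.
rewrite -(subrK (quad A B) f) -addrA; apply: ord_geD => //.
rewrite /quad (_ : _ - 1 = (A + B * W) * W); last by ring.
by apply: ord_geMl; ord0.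
Qed.

(** The two equations on A and B compare the coefficients of W and W^2 in f2 f0 = f1^2 + h. They
    suffice because f0 is 1 modulo order 1, hence invertible. *)
Lemma quad_step f0 f1 f2 h A0 B0 A1 B1 A2 B2 C D :
  ord_ge 0 A0 -> ord_ge 0 B0 -> ord_ge 0 A1 -> ord_ge 0 B1 ->
  ord_ge 0 C -> ord_ge 0 D ->
  ord_ge 3 (f0 - quad A0 B0) -> ord_ge 3 (f1 - quad A1 B1) ->
  ord_ge 3 (h - (C * W + D * W ^+ 2)) ->
  A2 + A0 = 2 * A1 + C -> B2 + B0 + A2 * A0 = 2 * B1 + A1 ^+ 2 + D ->
  f2 * f0 = f1 ^+ 2 + h ->
  ord_ge 3 (f2 - quad A2 B2).
Proof.
move=> A00 B00 A10 B10 C0 D0 f0E f1E hE /(canRL (addrK _)) A2E.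
move=> /(canRL (addrK _)) /(canRL (addrK _)) B2E f2E.
have two : ord_ge 0 2 by rewrite -(rmorph_nat iota); apply: ord_ge_iota.
have A20 : ord_ge 0 A2 by rewrite A2E; ord0.
have B20 : ord_ge 0 B2 by rewrite B2E; ord0.
have [f0_neq0 f0V] :=
  ord_ge_unit _ _ _ _ _ iota_inj _ (ord_ge_quad _ _ 3 _ isT A00 B00 f0E).
have q0 A B : ord_ge 0 A -> ord_ge 0 B -> ord_ge 0 (quad A B).
  by rewrite /quad => *; ord0.
have f10 : ord_ge 0 f1.
  by rewrite -(subrK (quad A1 B1) f1); apply: ord_geD; [apply: ord_geW f1E|exact: q0].
suff: ord_ge 3 ((f2 - quad A2 B2) * f0).
  by move=> /ord_geMr/(_ f0V); rewrite mulfK.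
(* The last summand collects the W^3 and W^4 terms of [quad A1 B1 ^+ 2 - quad A2 B2 * quad A0 B0];
   the lower ones cancel against C W + D W^2. *)
have -> : (f2 - quad A2 B2) * f0 =
    (f1 - quad A1 B1) * (f1 + quad A1 B1) + (h - (C * W + D * W ^+ 2))
    - quad A2 B2 * (f0 - quad A0 B0)
    + (2 * A1 * B1 - A0 * B2 - A2 * B0 + W * (B1 ^+ 2 - B0 * B2)) * W ^+ 3.
  by rewrite mulrBl f2E /quad B2E A2E; ring.
have W3 : ord_ge 3 (W ^+ 3) := ord_geX _ _ _ _ _ _ _ 3 W_ord.
apply: ord_geD; last by apply: ord_geMl => //; ord0.
apply: ord_geB; last by apply: ord_geMl => //; exact: q0.
by apply: ord_geD => //; apply: ord_geMr => //; apply: ord_geD => //; exact: q0.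
Qed.

Definition coefW1 (a b : nat) : F := (b%:R - 1) * p + (a%:R - 1) * q.
Definition coefW2 (a b : nat) : F :=
  (b%:R - 1) * (b%:R - 2) / 2 * p ^+ 2 + (a%:R * b%:R - 4 * a%:R + 2) * (p * q)
  + (a%:R - 1) * (a%:R - 2) / 2 * q ^+ 2.

Lemma ord_ge_nat n : ord_ge 0 n%:R.
Proof. by rewrite -(rmorph_nat iota); apply: ord_ge_iota. Qed.

Lemma coefW1_ord a b : ord_ge 0 (coefW1 a b).
Proof. by rewrite /coefW1; have N := ord_ge_nat; ord0. Qed.

Lemma coefW2_ord a b : ord_ge 0 (coefW2 a b).
Proof. by rewrite /coefW2; have N := ord_ge_nat; ord0. Qed.

(** Strong induction on m + n through [markov_descent]. The closed formula fails at (0, 1) and (1,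
    1), so those values of (a, b) are separate cases; in all others the last term of the recurrence
    is negligible. *)
Lemma quad_recurrence (G : nat -> nat -> F) :
  G 1%N 0%N = 1 -> G 0%N 1%N = 1 -> G 1%N 1%N = 1 ->
  (forall a b c d, markov_index a b -> markov_index c d ->
     (a * d = b * c + 1)%N \/ (b * c = a * d + 1)%N ->
     (a + 2 * c <= b + 2 * d)%N -> (0 < b + 2 * d)%N -> G a b != 0 ->
     G (a + 2 * c)%N (b + 2 * d)%N * G a b
       = G (a + c)%N (b + d)%N ^+ 2 + p ^+ a * q ^+ b * W ^+ (a + b) * G c d ^+ 2) ->
  forall m n, coprime m n -> (0 < m < n)%N ->
  ord_ge 3 (G m n - quad (coefW1 m n) (coefW2 m n)).
Proof.
move=> G10 G01 G11 Grec m n.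
have [k] := ubnP (m + n)%N; elim: k m n => // k IHk m n lt_k co_mn lt_mn.
have o1 := ord_ge1 _ _ _ iota phi; have o0 : ord_ge 0 0 by rewrite -(subrr 1); ord0.
have q00 : ord_ge 3 (1 - quad 0 0).
  by rewrite /quad !mul0r !addr0 subrr -(mul0r (W ^+ 3)); apply/ord_geMl/(ord_geX _ _ _ _ _ 1).
have zero3 : ord_ge 3 (0 - (0 * W + 0 * W ^+ 2)).
  by have := q00; rewrite /quad !mul0r !addr0 !subrr.
have idx a b : coprime a b -> (a <= b)%N -> markov_index a b.
  by rewrite /markov_index => -> ->.
have [[mE nE]|[a [b [c [d [mE nE le_ab le_cd det]]]]]] := markov_descent _ _ co_mn lt_mn.
  (* The only use of 1/0: it gives G 1 2 = 1 + p W exactly. *)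
  have := Grec 1%N 0%N 0%N 1%N isT isT (or_introl erefl) isT isT.
  rewrite mE nE G10 G11 G01 => /(_ (oner_neq0 _)) rec.
  apply: (quad_step _ _ _ _ 0 0 0 0 _ _ p 0 _ _ _ _ _ _ _ _ _ _ _ rec) => //.
  - have := zero3; rewrite !mul0r !addr0 subr0 expr1 expr0 expr1n !mulr1.
    by rewrite subrr.
  - by rewrite /coefW1; ring.
  - by rewrite /coefW2; field.
have co_ab := coprime_det1 _ _ _ _ det.
have co_cd : coprime c d.
  by apply: (@coprime_det1 c d a b); lia.
have G1 a' b' : (a' + b' < k)%N -> (a' <= b')%N -> coprime a' b' -> ord_ge 1 (G a' b' - 1).
  move=> lt_k' le' co'.
  have sub11 : ord_ge 1 (1 - 1) by apply: (ord_ge_le _ _ _ _ _ 1 3) => //;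
    have := zero3; rewrite !mul0r !addr0 !subrr.
  have [a'0|a'0] := posnP a'.
    by move: co'; rewrite a'0 /coprime gcd0n => /eqP ->; rewrite G01.
  have [a'E|neq] := eqVneq a' b'.
    by move: co'; rewrite a'E /coprime gcdnn => /eqP ->; rewrite G11.
  apply: (ord_ge_quad (coefW1 a' b') (coefW2 a' b') 3) => //;
    [exact: coefW1_ord|exact: coefW2_ord|apply: IHk => //; lia].
(* At (1, 1) the formula has W^2-coefficient - p q instead of 0, but it is right modulo W^2. That
   precision is enough for [G c d] when (a, b) = (0, 1), where its square carries a factor W. *)
have IH2 a' b' : (a' + b' < k)%N -> (0 < a' <= b')%N -> coprime a' b' ->
    ord_ge 2 (G a' b' - quad (coefW1 a' b') (coefW2 a' b')).
  move=> lt_k' le' co'; have [a'E|neq] := eqVneq a' b'.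
    move: co'; rewrite a'E /coprime gcdnn => /eqP ->; rewrite G11.
    rewrite /quad (_ : coefW1 1 1 = 0); last by rewrite /coefW1; ring.
    rewrite mul0r addr0 opprD addNKr.
    apply/ord_geN/ord_geMl; [exact: coefW2_ord|exact: (ord_geX _ _ _ _ _ 1 _ 2)].
  by apply: (ord_ge_le _ _ _ _ _ 2 3) => //; apply: IHk => //; lia.
have lt_acbd : (a + c < b + d)%N.
  rewrite ltn_neqAle leq_add // andbT; apply/eqP => E.
  have [aE cE] : a = b /\ c = d by lia.
  by move: det; rewrite aE cE; lia.
have ac_gt0 : (0 < a + c)%N by case: (posnP (a + c)) => // /eqP; rewrite addn_eq0;
  move=> /andP[/eqP aE /eqP cE]; move: det; rewrite aE cE; lia.
have co_ac : coprime (a + c) (b + d) by apply: (coprime_det1 _ _ c d); lia.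
have d_gt0 : (0 < d)%N.
  case: (posnP d) => // dE; have cE : c = 0%N by lia.
  by move: det; rewrite dE cE; lia.
have lt_ack : (a + c + (b + d) < k)%N by lia.
have lt_abk : (a + b < k)%N by lia.
have lt_cdk : (c + d < k)%N by lia.
have Gac := IHk _ _ lt_ack co_ac (introT andP (conj ac_gt0 lt_acbd)).
have Gcd1 := G1 _ _ lt_cdk le_cd co_cd.
have Gab1 := G1 _ _ lt_abk le_ab co_ab.
have [Gab_neq0 _] := ord_ge_unit _ _ _ _ _ iota_inj _ Gab1.
have [_ lt_mn'] := andP lt_mn.
have := Grec a b c d (idx _ _ co_ab le_ab) (idx _ _ co_cd le_cd) det.
rewrite -mE -nE => /(_ (ltnW lt_mn') (leq_ltn_trans (leq0n _) lt_mn') Gab_neq0) rec.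
have natE := (natrD, natrM).
have W1 e : ord_ge e (W ^+ e).
  by have := ord_geX _ _ _ _ _ _ _ e W_ord; rewrite mul1n.
have Gcd0 : ord_ge 0 (G c d).
  by rewrite -(subrK 1 (G c d)); apply: ord_geD => //; apply: ord_geW Gcd1.
have [aE|a0] := posnP a.
  have bE : b = 1%N by move: co_ab; rewrite aE /coprime gcd0n => /eqP.
  have cE : c = 1%N by move: det; rewrite aE bE; lia.
  move: rec Gac; rewrite aE bE G01 => rec Gac.
  (* Here the last term is q W (G c d)^2, and (G c d)^2 is 1 + 2 [coefW1 c d] W modulo order 2. *)
  apply: (quad_step _ _ _ _ 0 0 _ _ _ _ q (2 * q * coefW1 c d) _ _ _ _ _ _ _ Gac _ _ _ rec);
    rewrite ?G01 //; try exact: coefW1_ord; try exact: coefW2_ord.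
  - by have := coefW1_ord c d; have := ord_ge_nat 2 => *; ord0.
  - have Gcd := IH2 c d lt_cdk _ co_cd; rewrite cE in Gcd *.
    set A := coefW1 1 d in Gcd *; set B := coefW2 1 d in Gcd *; set Q := quad A B in Gcd *.
    have Ao : ord_ge 0 A := coefW1_ord _ _; have Bo : ord_ge 0 B := coefW2_ord _ _.
    have two := ord_ge_nat 2.
    rewrite (_ : _ - _ = q * (W * ((G 1%N d - Q) * (G 1%N d + Q)
      + (2 * B + A ^+ 2 + 2 * A * B * W + B ^+ 2 * W ^+ 2) * W ^+ 2))); last first.
      by rewrite /Q /quad; ring.
    apply: ord_geMl => //; apply: (ord_geM _ _ _ _ _ 1 2) => //.
    apply: ord_geD; last by apply: ord_geMl => //; ord0.
    apply: ord_geMr; first by apply: Gcd; lia.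
    by apply: ord_geD; [move: Gcd0; rewrite cE|rewrite /Q /quad; ord0].
  - by rewrite mE nE aE bE cE /coefW1 !natE; ring.
  - by rewrite mE nE aE bE cE /coefW1 /coefW2 !natE; field.
have [abE|neq_ab] := eqVneq a b.
  have bE : b = 1%N by move: co_ab; rewrite abE /coprime gcdnn => /eqP.
  have dE : d = c.+1 by move: det; rewrite abE bE; lia.
  have aE : a = 1%N by rewrite abE.
  move: rec Gac; rewrite aE bE G11 => rec Gac.
  (* Here the last term is p q W^2 (G c d)^2, and only the constant term 1 of (G c d)^2 counts. *)
  apply: (quad_step _ _ _ _ 0 0 _ _ _ _ 0 (p * q) _ _ _ _ _ _ _ Gac _ _ _ rec);
    rewrite ?G01 //; try exact: coefW1_ord; try exact: coefW2_ord.
  - by ord0.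
  - rewrite (_ : _ - _ = p * q * (W ^+ 2 * ((G c d - 1) * (G c d + 1)))); last by ring.
    apply: ord_geMl; first by ord0.
    by apply: (ord_geM _ _ _ _ _ 2 1) => //; apply: ord_geMr => //; ord0.
  - by rewrite mE nE aE bE dE -[c.+1]addn1 /coefW1 !natE; ring.
  - by rewrite mE nE aE bE dE -[c.+1]addn1 /coefW1 /coefW2 !natE; field.
have Gab := IHk a b lt_abk co_ab _.
apply: (quad_step _ _ _ _ _ _ _ _ _ _ 0 0 _ _ _ _ _ _ (Gab _) Gac _ _ _ rec) => //;
  try exact: coefW1_ord; try exact: coefW2_ord.
- by lia.
(* Now 1 <= a < b, so a + b >= 3 and the last term has order at least 3. *)
- rewrite !mul0r addr0 subr0 mulrAC; apply: ord_geMl; first by ord0.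
  by apply: (ord_ge_le _ _ _ _ _ 3 (a + b)) => //; lia.
- by rewrite mE nE /coefW1 !natE; ring.
- by rewrite mE nE /coefW1 /coefW2 !natE; field.
Qed.
End Truncation.

(** * Squared variables and dehomogenization *)

(** This will serve as [iota]; the variables of the source are u, v, w. *)
Definition squares : {rmorphism poly3 -> K3} :=
  @FracField.tofrac poly3 \o
    comp_mpoly [tuple ('X_0 : poly3) ^+ 2; ('X_1 : poly3) ^+ 2; ('X_2 : poly3) ^+ 2].

Lemma squaresE P : squares P = toK (sq_subst P).
Proof. by []. Qed.

Lemma sq_substX (m : 'X_{1..3}) : sq_subst 'X_[m] = 'X_[m *+ 2].
Proof.
rewrite /sq_subst comp_mpolyX [RHS]mpolyXE_id !big_ord_recl !big_ord0 /=.
rewrite !(tnth_nth 0) /= -!exprM !mulmnE !(mulnC 2%N).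
by congr ('X_ _ ^+ _ * ('X_ _ ^+ _ * ('X_ _ ^+ _ * 1))); apply/val_inj.
Qed.

Lemma mcoeff_sq_subst P m : (sq_subst P)@_(m *+ 2) = P@_m.
Proof.
rewrite [in RHS](mpolyE P) [sq_subst P]comp_mpolyEX !raddf_sum /=.
apply: eq_bigr => m' _; rewrite -[_ \mPo _]/(sq_subst _) sq_substX !mcoeffZ !mcoeffX.
congr (_ * (_ : bool)%:R); apply/eqP/eqP => [/mnmP E|-> //]; apply/mnmP => i.
by have := E i; rewrite !mulmnE => /eqP; rewrite eqn_pmul2r // => /eqP.
Qed.

Lemma squares_inj : injective squares.
Proof.
move=> P Q /eqP; rewrite !squaresE tofrac_eq => /eqP E.
by apply/mpolyP => m; rewrite -[LHS]mcoeff_sq_subst E mcoeff_sq_subst.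
Qed.

(* Setting X_1 := 1 loses nothing on homogeneous polynomials. *)
Definition dehomog : {rmorphism poly3 -> {poly {poly int}}} :=
  mmap intr (fun i : 'I_3 => nth 0 [:: 'X%:P; 1; 'X] i).

Lemma dehomogX i : dehomog 'X_i = nth 0 [:: 'X%:P; 1; 'X] i.
Proof. by rewrite /dehomog /= mmapX mmap1U. Qed.

(** In degree d the exponent of v is determined by the other two, so no monomials merge. The outer
    variable is w, the inner one u. *)
Lemma coef_dehomog d (P : poly3) i k : P \is d.-homog ->
  (dehomog P)`_k`_i = if (i + k <= d)%N then P@_(mon3 i (d - i - k) k) else 0.
Proof.
have lift2 : lift ord0 (lift ord0 ord0) = 2 :> 'I_3 by apply/val_inj.
move=> homP; rewrite /dehomog /= /mmap !coef_sum.
transitivity (\sum_(m <- msupp P) P@_m * ((m 0 == i) && (m 2%R == k))%:R).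
  apply: eq_bigr => m _.
  rewrite /mmap1 !big_ord_recl big_ord0 /= expr1n mul1r mulr1.
  rewrite lift2 [m 2 == k]eq_sym -polyC_exp -[_%:~R](rmorph_int polyC) mulrA -polyCM coefCM coefXn.
  case: (k == _); rewrite ?andbF ?mulr0 ?coef0 // andbT mulr1.
  by rewrite -[_%:~R](rmorph_int polyC) coefCM coefXn eq_sym intz.
case: leqP => [le_ikd|lt_dik].
  rewrite [in RHS](mpolyE P) raddf_sum /= !big_seq; apply: eq_bigr => m Pm.
  rewrite mcoeffZ mcoeffX; congr (_ * (_ : bool)%:R).
  have : mdeg m = d := dhomog_mf homP Pm; rewrite mdegE !big_ord_recl big_ord0 addn0.
  move=> degm; apply/andP/eqP => [[/eqP m0 /eqP m2]|->]; last by rewrite !mnmE.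
  apply/mnmP => j; rewrite mnmE.
  case: j => [[|[|[|//]]] j3] /=.
  - by rewrite -m0; congr (m _); apply/val_inj.
  - have <- : m (lift ord0 ord0) = m (Ordinal j3) by congr (m _); apply/val_inj.
    by move: degm; rewrite lift2 m2 -[m ord0]/(m 0) m0; lia.
  - by rewrite -m2; congr (m _); apply/val_inj.
rewrite big_seq big1 // => m Pm.
have : mdeg m = d := dhomog_mf homP Pm; rewrite mdegE !big_ord_recl big_ord0 addn0.
rewrite lift2 -[m ord0]/(m 0) => degm.
by case: andP => [[/eqP m0 /eqP m2]|]; [lia|rewrite mulr0].
Qed.

(** * Normalized Markov polynomials and cleared denominators *)

(** This is G_{a,b}. The exponents a - 1, b - 1 and a + b - 1 are written as quotients so that they
    are right also when a = 0 or b = 0. *)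
Definition normalize (F : fieldType) (x y z s : F) (a b : nat) (m : F) : F :=
  m * (x ^+ a * y ^+ b * z ^+ (a + b)) / (x * y * z) * (s / s ^+ (a + b)).

(** The indices on the left add up to 2 (a + c, b + d), so the m2 term is scaled exactly as a
    square. The m1 term keeps the scaling for 2 (a, b), which is the displayed monomial in x^2 / s,
    y^2 / s, z^2 / s. *)
Lemma normalize_recurrence (F : fieldType) (x y z s m0 m1 m2 m3 : F) (a b c d : nat) :
  x != 0 -> y != 0 -> z != 0 -> s != 0 -> m0 != 0 -> m3 = (m1 ^+ 2 + m2 ^+ 2) / m0 ->
  normalize F x y z s (a + 2 * c) (b + 2 * d) m3 * normalize F x y z s a b m0
  = normalize F x y z s (a + c) (b + d) m2 ^+ 2
    + (x ^+ 2 / s) ^+ a * (y ^+ 2 / s) ^+ b * (z ^+ 2 / s) ^+ (a + b)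
      * normalize F x y z s c d m1 ^+ 2.
Proof.
move=> x0 y0 z0 s0 m00 ->; rewrite /normalize !(exprD, exprM, expr_div_n) !(exprAC _ 2).
have X n : x ^+ n != 0 by rewrite expf_neq0.
have Y n : y ^+ n != 0 by rewrite expf_neq0.
have Z n : z ^+ n != 0 by rewrite expf_neq0.
have T n : s ^+ n != 0 by rewrite expf_neq0.
have XA := X a; have XC := X c; have YB := Y b; have YD := Y d.
have ZA := Z a; have ZB := Z b; have ZC := Z c; have ZD := Z d.
have TA := T a; have TB := T b; have TC := T c; have TD := T d.
move: XA XC YB YD ZA ZB ZC ZD TA TB TC TD.
move: (x ^+ a) (x ^+ c) (y ^+ b) (y ^+ d) => xa xc yb yd.
move: (z ^+ a) (z ^+ b) (z ^+ c) (z ^+ d) => za zb zc zd.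
move: (s ^+ a) (s ^+ b) (s ^+ c) (s ^+ d) => sa sb sc sd *.
by field; do !(apply/andP; split=> //).
Qed.

Lemma absz_det1 (a b c d : nat) :
  (a * d = b * c + 1)%N \/ (b * c = a * d + 1)%N -> `|(a * d)%:Z - (b * c)%:Z| = 1.
Proof. by case=> ->; lia. Qed.

Lemma normalize_init (F : fieldType) (x y z s : F) :
  x != 0 -> y != 0 -> z != 0 -> s != 0 ->
  [/\ normalize F x y z s 1 0 y = 1, normalize F x y z s 0 1 x = 1 &
      normalize F x y z s 1 1 (s / z) = 1].
Proof.
by move=> x0 y0 z0 s0; split; rewrite /normalize ?expr0 ?expr1;
  field; do !(apply/andP; split=> //).
Qed.

Lemma normalize_numerator (F : fieldType) (x y z s m P : F) (a b : nat) :
  x != 0 -> y != 0 -> z != 0 -> s != 0 -> (0 < a)%N -> (0 < b)%N ->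
  m = P / (x ^+ (a - 1) * y ^+ (b - 1) * z ^+ (a + b - 1)) ->
  normalize F x y z s a b m = P / s ^+ (a + b - 1).
Proof.
case: a b => [|a] [|b] // x0 y0 z0 s0 _ _ ->; rewrite /normalize.
rewrite addSn !subn1 !succnK !(exprS _ (_ + _)) !exprS.
have := expf_neq0 (a + b.+1) z0; have := expf_neq0 (a + b.+1) s0.
have := expf_neq0 a x0; have := expf_neq0 b y0.
move: (x ^+ a) (y ^+ b) (z ^+ _) (s ^+ _) => xa yb zn sn *.
by field; do !(apply/andP; split=> //).
Qed.

(* With s = u + v, this is 2 s^4 (P - s^n (1 + A W + B W^2)), where W = w / s and A, B
   are coefW1, coefW2 at u / s and v / s. *)
Definition residual (R : comNzRingType) (u v w P : R) (a b n : nat) : R :=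
  2 * P * (u + v) ^+ 4
  - (u + v) ^+ n * (2 * (u + v) ^+ 4
    + 2 * ((b%:R - 1) * u + (a%:R - 1) * v) * (u + v) ^+ 2 * w
    + ((b%:R - 1) * (b%:R - 2) * u ^+ 2 + 2 * (a%:R * b%:R - 4 * a%:R + 2) * (u * v)
       + (a%:R - 1) * (a%:R - 2) * v ^+ 2) * w ^+ 2).

Lemma rmorph_residual (R R' : comNzRingType) (f : {rmorphism R -> R'}) u v w P a b n :
  f (residual R u v w P a b n) = residual R' (f u) (f v) (f w) (f P) a b n.
Proof.
by rewrite /residual !(rmorphB, rmorphD, rmorphM, rmorphXn, rmorph_nat, rmorph1).
Qed.

Lemma quad_clear_denominators (F : fieldType) (u v w P : F) (a b n : nat) :
  let s := u + v in 2 != 0 :> F -> s != 0 ->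
  (P / s ^+ n - quad F (w / s) (coefW1 F (u / s) (v / s) a b) (coefW2 F (u / s) (v / s) a b))
    * (2 * s ^+ n * s ^+ 4)
  = residual F u v w P a b n.
Proof.
move=> s two0 s0; rewrite /residual -/s.
rewrite /quad /coefW1 /coefW2; have := expf_neq0 n s0.
move: (s ^+ n) => t t0; move: s s0 => s s0.
field.
by do !(apply/andP; split=> //).
Qed.

(** With v = 1 the sum u + v is a constant 1 + X of the inner ring, so the subtracted part is
    quadratic in w and its w^2 coefficient can be read off. *)
Lemma coef_residual (p : {poly {poly int}}) (a b n : nat) :
  (residual _ 'X%:P 1 'X p a b n)`_2
  = 2 * p`_2 * (1 + 'X) ^+ 4
    - (1 + 'X) ^+ n * Poly [:: (a%:Z - 1) * (a%:Z - 2); 2 * (a%:Z * b%:Z - 4 * a%:Z + 2);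
                               (b%:Z - 1) * (b%:Z - 2)].
Proof.
pose s : {poly int} := 1 + 'X.
have sE : 'X%:P + 1 = s%:P :> {poly {poly int}} by rewrite polyCD addrC.
pose K0 : {poly int} := 2 * s ^+ n * s ^+ 4.
pose K1 : {poly int} := s ^+ n * s ^+ 2 * (2 * ((b%:R - 1) * 'X + (a%:R - 1))).
pose K2 : {poly int} := (b%:R - 1) * (b%:R - 2) * 'X ^+ 2
  + 2 * (a%:R * b%:R - 4 * a%:R + 2) * 'X + (a%:R - 1) * (a%:R - 2).
have -> : residual _ 'X%:P 1 'X p a b n =
    p * (2 * s ^+ 4)%:P - (K0%:P + K1%:P * 'X + (s ^+ n * K2)%:P * 'X^2).
  rewrite /residual sE /K0 /K1 /K2 !(rmorphB, rmorphD, rmorphM, rmorphXn, rmorph_nat, rmorph1) /=.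
  by ring.
rewrite coefB coefMC !coefD coefC !coefCM coefX coefXn /= !mulr0 !add0r mulr1.
congr (_ - _ * _); first by rewrite -/s; ring.
rewrite /= !cons_poly_def /K2 -!natz.
by rewrite !(rmorphB, rmorphD, rmorphM, rmorph_nat, rmorph1, rmorph0) /=; ring.
Qed.

(** * The part of the numerator of w-degree 2 *)

(** The truncated recurrence shows that the residual, which is the image of a polynomial, has order
    at least 3 in w; hence its w^2 coefficient vanishes. *)
Lemma numerator_coef2 (M : nat -> nat -> K3) (a b : nat) (P : poly3) :
  is_markov_family M -> (0 < a < b)%N -> coprime a b -> is_markov_numerator M a b P ->
  2 * (dehomog P)`_2 * (1 + 'X) ^+ 4
  = (1 + 'X) ^+ (a + b - 1) *
    Poly [:: (a%:Z - 1) * (a%:Z - 2); 2 * (a%:Z * b%:Z - 4 * a%:Z + 2);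
             (b%:Z - 1) * (b%:Z - 2)].
Proof.
move=> [M10 M01 M11 Mrec] lt_ab co_ab [_ MP].
pose s := vx ^+ 2 + vy ^+ 2.
have uE : squares 'X_0 = vx ^+ 2 by rewrite squaresE /sq_subst comp_mpolyXU /toK /= rmorphXn.
have vE : squares 'X_1 = vy ^+ 2 by rewrite squaresE /sq_subst comp_mpolyXU /toK /= rmorphXn.
have wE : squares 'X_2 = vz ^+ 2 by rewrite squaresE /sq_subst comp_mpolyXU /toK /= rmorphXn.
have sE : squares ('X_0 + 'X_1) = s by rewrite rmorphD uE vE.
(* The sum u + v does not involve w, so division by s does not lower orders. *)
have s_unit : (dehomog ('X_0 + 'X_1))`_0 != 0.
  rewrite rmorphD !dehomogX /= coefD coefC coef1 /=.
  by rewrite -size_poly_gt0 size_XaddC.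
have two_unit : (dehomog 2)`_0 != 0.
  by rewrite rmorph_nat -polyC_natr coefC /= -polyC_natr polyC_eq0.
have s0 : s != 0 by rewrite -sE (iota_neq0 _ _ _ squares dehomog squares_inj).
have [x0 y0 z0] : [/\ vx != 0, vy != 0 & vz != 0].
  by split; rewrite tofrac_eq0 -msupp_eq0 msuppX.
have two0 : 2 != 0 :> K3.
  by rewrite -(rmorph_nat squares) (iota_neq0 _ _ _ squares dehomog squares_inj).
have half : ord_ge _ _ _ squares dehomog 0 2^-1.
  by rewrite -(rmorph_nat squares); apply: ord_ge_iotaV squares_inj _ two_unit.
have sV : ord_ge _ _ _ squares dehomog 0 s^-1.
  by rewrite -sE; apply: ord_ge_iotaV squares_inj _ s_unit.
have p_ord : ord_ge _ _ _ squares dehomog 0 (vx ^+ 2 / s).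
  by apply: ord_geMl sV; rewrite -uE; apply: ord_ge_iota.
have q_ord : ord_ge _ _ _ squares dehomog 0 (vy ^+ 2 / s).
  by apply: ord_geMl sV; rewrite -vE; apply: ord_ge_iota.
have W_ord : ord_ge _ _ _ squares dehomog 1 (vz ^+ 2 / s).
  apply: ord_geMr sV; exists 'X_2, 1, 1.
  by rewrite !rmorph1 coef1 oner_neq0 mulr1 mul1r wE dehomogX.
have [N10 N01 N11] := normalize_init _ _ _ _ _ x0 y0 z0 s0.
have := quad_recurrence _ _ _ squares dehomog squares_inj _ _ _ p_ord q_ord W_ord
  two0 half (fun a b => normalize _ vx vy vz s a b (M a b)).
rewrite M10 M01 M11 => /(_ N10 N01 N11) => /(_ _ _ _ co_ab lt_ab) trunc.
have {}trunc : ord_ge _ _ _ squares dehomog 3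
    (normalize _ vx vy vz s a b (M a b) - quad _ (vz ^+ 2 / s)
      (coefW1 _ (vx ^+ 2 / s) (vy ^+ 2 / s) a b) (coefW2 _ (vx ^+ 2 / s) (vy ^+ 2 / s) a b)).
  apply: trunc => a' b' c d idx_ab idx_cd det le0 lt0 N0.
  cbv beta in N0 |- *; have m_neq0 : M a' b' != 0.
    by apply: contraNneq N0 => ->; rewrite /normalize !mul0r.
  apply: (normalize_recurrence K3 _ _ _ _ _ _ _ _ _ _ _ _ x0 y0 z0 s0 m_neq0).
  exact: (Mrec _ _ _ _ idx_ab idx_cd (absz_det1 _ _ _ _ det) le0 lt0).
have [a_gt0 lt_ab'] := andP lt_ab; have b_gt0 := leq_trans a_gt0 (ltnW lt_ab').
rewrite (normalize_numerator _ _ _ _ _ _ _ _ _ x0 y0 z0 s0 a_gt0 b_gt0 MP) in trunc.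
have two_ord : ord_ge _ _ _ squares dehomog 0 (2 * s ^+ (a + b - 1) * s ^+ 4).
  rewrite -sE -(rmorph_nat squares) -!rmorphXn -!rmorphM; exact: ord_ge_iota.
have {trunc two_ord} := ord_geMr _ _ _ _ _ _ _ _ trunc two_ord.
rewrite (quad_clear_denominators _ _ _ _ _ _ _ _ two0 s0) -squaresE -uE -vE -wE -rmorph_residual.
move=> /ord_ge_iota_coef - /(_ squares_inj 2%N isT).
rewrite rmorph_residual !dehomogX coef_residual => /eqP.
by rewrite subr_eq0 => /eqP.
Qed.

(** On this line the exponent of w is 2. For i > a + b - 3 both sides are 0: j is negative, and i +
    2 exceeds the degree. *)
Lemma coefA_dehomog (a b : nat) (P : poly3) (i : int) :
  (2 < a + b)%N -> P \is (a + b - 1)%N.-homog ->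
  coefA a b P i ((a + b - 3)%N%:Z - i)
  = if 0 <= i then (dehomog P)`_2`_`|i|%N else 0.
Proof.
move=> n_gt2 homP; rewrite /coefA; case: i => [i|i] //.
rewrite (coef_dehomog _ _ _ _ homP) /= [`|_|%N]/=.
have [le_in|lt_ni] := leqP i (a + b - 3).
  rewrite -subzn // !ifT; try lia.
  by congr (P@_(mon3 _ _ _)); lia.
by rewrite !ifF //; lia.
Qed.

(* The hypothesis a / b <= 3 / 5 is used to get 2 (ab - 4a + 2) >= (a - 1) (b - 1). *)
Lemma coefW2_bounds (a b : nat) : (0 < a < b)%N -> (5 * a <= 3 * b)%N ->
  let p := (b%:Z - 1) * (b%:Z - 2) in let q := 2 * (a%:Z * b%:Z - 4 * a%:Z + 2) in
  let r := (a%:Z - 1) * (a%:Z - 2) in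
  [/\ 0 <= p, 0 <= q, 0 <= r & p * r <= q ^+ 2].
Proof.
move=> lt_ab le_ab p q r; have [a_gt0 lt_ab'] := andP lt_ab.
have xy_ge0 : 0 <= (a%:Z - 1) * (b%:Z - 1) by rewrite mulr_ge0 //; lia.
(* The difference is a (b - 7) + b + 3, clearly positive for b >= 7; smaller b are checked one by
   one. *)
have q_ge : (a%:Z - 1) * (b%:Z - 1) <= q.
  rewrite /q; have [|gt_b6] := leqP b 6.
    move=> le_b6; have : b = 2%N \/ b = 3%N \/ b = 4%N \/ b = 5%N \/ b = 6%N by lia.
    by case=> [|[|[|[|]]]] bE; rewrite bE in lt_ab' le_ab *; lia.
  have : 0 <= a%:Z * (b%:Z - 7) by rewrite mulr_ge0 //; lia.
  lia.
split; first by rewrite mulr_ge0 //; lia.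
- exact: le_trans q_ge.
- by rewrite /r; have [->|a_neq1] := eqVneq a 1%N; [|rewrite mulr_ge0 //; lia].
apply: (@le_trans _ _ (((a%:Z - 1) * (b%:Z - 1)) ^+ 2)); last first.
  by rewrite lerXn2r ?nnegrE // (le_trans xy_ge0).
(* This product is (a - 1)^2 (b - 1)^2 - p r. *)
have : 0 <= (a%:Z - 1) * (b%:Z - 1) * (a%:Z + b%:Z - 3).
  by rewrite mulr_ge0 //; lia.
by rewrite /p /r; lia.
Qed.

Lemma numerator_coef2_log_concave (M : nat -> nat -> K3) (a b : nat) (P : poly3) (i : nat) :
  is_markov_family M -> (1 <= a)%N -> (1 <= b)%N -> coprime a b -> (5 * a <= 3 * b)%N ->
  is_markov_numerator M a b P ->
  (dehomog P)`_2`_i * (dehomog P)`_2`_i.+2 <= (dehomog P)`_2`_i.+1 ^+ 2.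
Proof.
move=> MM a0 b0 co_ab le_ab MP; have lt_ab : (0 < a < b)%N by lia.
have := numerator_coef2 _ _ _ _ MM lt_ab co_ab MP.
have := coefW2_bounds a b lt_ab le_ab.
set Q := (dehomog P)`_2; set p := (b%:Z - 1) * (b%:Z - 2).
set q := 2 * _; set r := (a%:Z - 1) * (a%:Z - 2) => -[p_ge0 q_ge0 r_ge0 disc] QE.
(* Cancelling (1 + X)^4 gives this form with n = a + b - 5. For a + b < 5 only (1, 2) and (1, 3)
   remain, where 2 Q is 0 and 2 X. *)
suff [n [p' [q' [r' [p'0 q'0 r'0 disc' Q2E]]]]] : exists n (p' q' r' : int),
    [/\ 0 <= p', 0 <= q', 0 <= r', p' * r' <= q' ^+ 2 &
        2 * Q = (1 + 'X) ^+ n * Poly [:: r'; q'; p']].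
  have [||_ lc] := log_concave_mul1Xn (Poly [:: r'; q'; p']) n.
  - by move=> [|[|[|j]]]; rewrite coef_Poly //= nth_nil.
  - by move=> j k; apply: log_concave_quadratic.
  have := lc i i (leqnn i).
  by rewrite -Q2E !mulr_natl !coefMn !mulrnAl !mulrnAr -!mulrnA ler_pMn2r.
have S0 k : (1 + 'X : {poly int}) ^+ k != 0.
  by rewrite expf_neq0 // addrC -size_poly_gt0 size_XaddC.
have [n_ge5|n_lt5] := leqP 5 (a + b).
  exists (a + b - 5)%N, p, q, r; split=> //.
  apply: (mulIf (S0 4)); rewrite QE mulrAC -exprD; congr (_ ^+ _ * _); lia.
have a1 : a = 1%N by lia.
have [b2|b3] : b = 2%N \/ b = 3%N by lia.
  exists 0%N, 0, 0, 0; split=> //; apply: (mulIf (S0 4)); rewrite QE /p /q /r a1 b2.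
  by rewrite /= !cons_poly_def; ring.
exists 0%N, 0, 2, 0; split=> //; apply: (mulIf (S0 4)); rewrite QE /p /q /r a1 b3.
by rewrite /= !cons_poly_def; ring.
Qed.

Theorem theorem6p7 (M : nat -> nat -> K3) (a b : nat) (P : poly3) :
  is_markov_family M ->
  (1 <= a)%N -> (1 <= b)%N -> coprime a b -> (5 * a <= 3 * b)%N ->
  is_markov_numerator M a b P ->
  forall i : int, let j := (a + b - 3)%N%:Z - i in
    coefA a b P (i - 1) (j + 1) * coefA a b P (i + 1) (j - 1)
      <= coefA a b P i j ^+ 2.
Proof.
move=> MM a0 b0 co_ab le_ab MP i /=; set j := _ - i; have [homP _] := MP.
have n_gt2 : (2 < a + b)%N by lia.
have [-> ->] : j + 1 = (a + b - 3)%N%:Z - (i - 1) /\ j - 1 = (a + b - 3)%N%:Z - (i + 1).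
  by rewrite /j; lia.
(* For i <= 0 the coefficient at i - 1 is 0, and the claim is that a square is nonnegative. *)
rewrite /j !coefA_dehomog //; case: i j => [[|i]|i] _; rewrite ?mul0r ?sqr_ge0 //=.
rewrite subn1 addn1.
exact: numerator_coef2_log_concave MM a0 b0 co_ab le_ab MP.
Qed.
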